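(* Suppose both Hamiltonians are affine in $p$, i.e. $H(q,p)=\langle p,f(q)\rangle+L(q)$ and $\mathcal{H}(q,p)=\langle p,\sigma(q)\rangle+\mathfrak{L}(q)$, with $f\in C^\infty(\mathbb{R}^N,\mathbb{R}^N)$, $\sigma\in C^\infty(\mathbb{R}^N,\mathcal{L}(\mathbb{R}^K,\mathbb{R}^N))$, $L\in C^\infty(\mathbb{R}^N,\mathbb{R})$, $\mathfrak{L}\in C^\infty(\mathbb{R}^N,\mathcal{L}(\mathbb{R}^K,\mathbb{R}))$. Then the rough Galerkin integrator together with the associated integrator for the linearised quantities possesses the discrete quasi-conservation law $$\langle p_k,\delta q_k\rangle=\langle p_{k+1},\delta q_{k+1}\rangle+\Delta t\sum_{i=1}^rb_i\Big\langle\frac{\partial L}{\partial q}(Q_{i,k}),\delta Q_{i,k}\Big\rangle+\sum_{i=1}^r\bar b_i\Big\langle\frac{\partial\mathfrak{L}}{\partial q}(Q_{i,k}),\delta Q_{i,k}\Big\rangle\cdot Z_{t_k,t_{k+1}},$$ where $Q_{i,k},\delta Q_{i,k}$ are the stage values of the solutions of the two integrators. As a special case, when $L(q)=\mathfrak{L}(q)=0$, the conservation law $\langle p_{k+1},\delta q_{k+1}\rangle=\langle p_k,\delta q_k\rangle$ holds.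
   Context: Let $\mathbf{Z}$ be a geometric $\alpha$-Hölder rough path in $\mathbb{R}^K$ over $[t_0,t_1]$, $\alpha\in(\frac13,\frac12]$, with increment $Z_{t_k,t_{k+1}}=Z_{t_{k+1}}-Z_{t_k}\in\mathbb{R}^K$ on a step $[t_k,t_{k+1}]$ of length $\Delta t$; ''$\cdot Z_{t_k,t_{k+1}}$'' is contraction over the $\mathbb{R}^K$ index; $[\langle p,\sigma(q)\rangle]_j=\sum_ip_i\sigma_{ij}(q)$. Rough Galerkin integrator: let $0=d_0<d_1<\dots<d_s=1$, $l_0,\dots,l_s$ the degree-$s$ Lagrange polynomials with $l_\mu(d_\nu)=\delta_{\mu\nu}$, $q_d(t_k+\eta\Delta t)=\sum_{\mu=0}^sq^\mu l_\mu(\eta)$, $\dot q_d(t_k+\eta\Delta t)=\frac1{\Delta t}\sum_{\mu=0}^sq^\mu\dot l_\mu(\eta)$, $q^0=q_k$. Let $0\le c_1\le\dots\le c_r\le1$ be quadrature points with weights $b_i,\bar b_i$, $Q_{i,k}=q_d(t_k+c_i\Delta t)$, $P_{i,k}\in\mathbb{R}^N$ stage momenta. Given $(q_k,p_{k+1})$, the integrator is defined by (derivatives of $H,\mathcal{H}$ at $(Q_{i,k},P_{i,k})$): $$-\Delta t\,b_i\big(\dot q_d(t_k+c_i\Delta t)-\tfrac{\partial H}{\partial p}\big)+\bar b_i\tfrac{\partial\mathcal{H}}{\partial p}\cdot Z_{t_k,t_{k+1}}=0,\quad i=1,\dots,r,$$ $$-\sum_{i=1}^rb_i\big(P_{i,k}\dot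 l_\mu(c_i)-\Delta t\tfrac{\partial H}{\partial q}l_\mu(c_i)\big)+\sum_{i=1}^r\bar b_i\tfrac{\partial\mathcal{H}}{\partial q}l_\mu(c_i)\cdot Z_{t_k,t_{k+1}}=\begin{cases}p_k,&\mu=0,\\0,&\mu=1,\dots,s-1,\\-p_{k+1},&\mu=s,\end{cases}$$ and $q_{k+1}=q^s$. These are the stationarity conditions, and the relations $p_k=\partial\mathcal{S}_d/\partial q_k$, $q_{k+1}=\partial\mathcal{S}_d/\partial p_{k+1}$, for the discrete generating function $\mathcal{S}_d(q_k,p_{k+1})$, the stationary value over $q^1,\dots,q^s,P_{1,k},\dots,P_{r,k}$ of $p_{k+1}q^s-\Delta t\sum_ib_i(P_{i,k}\dot q_d(t_k+c_i\Delta t)-H(Q_{i,k},P_{i,k}))+\sum_i\bar b_i\mathcal{H}(Q_{i,k},P_{i,k})\cdot Z_{t_k,t_{k+1}}$. Standing assumption: the integrator is solvable, with $q^\mu,P_{i,k}$ smooth in $(q_k,p_{k+1})$. Linearised integrator: the equations obtained by differentiating the defining equations of the rough Galerkin integrator (the equations indexed by $i=1,\dots,r$, the equations indexed by $\mu=0,\dots,s$, and $q_{k+1}=q^s$) along a smooth one-parameter family of solutions of those equations, for unknowns $\delta q^\mu,\delta P_{i,k}$ with $\delta q^0=\delta q_k$, $\delta q_d(t_k+\eta\Delta t)=\sum_\mu\delta q^\mu l_\mu(\eta)$, $\delta Q_{i,k}=\delta q_d(t_k+c_i\Delta t)$. Writing, for $F\in\{H,\mathcal{H}\}$, $\delta F^p_i=\frac{\partial^2F}{\partial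 p\partial p}\delta P_{i,k}+\frac{\partial^2F}{\partial p\partial q}\delta Q_{i,k}$ and $\delta F^q_i=\frac{\partial^2F}{\partial q\partial q}\delta Q_{i,k}+\frac{\partial^2F}{\partial q\partial p}\delta P_{i,k}$ (derivatives at $(Q_{i,k},P_{i,k})$), it reads $$-\Delta t\,b_i\big(\tfrac1{\Delta t}\textstyle\sum_\mu\delta q^\mu\dot l_\mu(c_i)-\delta H^p_i\big)+\bar b_i\,\delta\mathcal{H}^p_i\cdot Z_{t_k,t_{k+1}}=0,\quad i=1,\dots,r,$$ $$-\sum_{i=1}^rb_i\big(\delta P_{i,k}\dot l_\mu(c_i)-\Delta t\,\delta H^q_i\,l_\mu(c_i)\big)+\sum_{i=1}^r\bar b_i\,\delta\mathcal{H}^q_i\,l_\mu(c_i)\cdot Z_{t_k,t_{k+1}}=\begin{cases}\delta p_k,&\mu=0,\\0,&\mu=1,\dots,s-1,\\-\delta p_{k+1},&\mu=s,\end{cases}$$ and $\delta q_{k+1}=\delta q^s$. *)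

(* Defs.v *)
From mathcomp Require Import all_boot all_order all_algebra.
From mathcomp Require Import all_classical all_reals all_analysis.
Set Implicit Arguments.
Unset Strict Implicit.
Unset Printing Implicit Defensive.
Import Order.TTheory GRing.Theory Num.Theory.
Import numFieldNormedType.Exports.
Local Open Scope classical_set_scope.
Local Open Scope ring_scope.

(* For U open and V finite-dimensional (the only use made of it), this is the
   usual C^n regularity on U: the values of f outside U are irrelevant. *)
Fixpoint Ck_on (R : realType) (V W : normedModType R) (U : set V) (n : nat)
    (f : V -> W) : Prop :=
  match n with
  | 0 => forall x, U x -> {for x, continuous f}
  | m.+1 => (forall x, U x -> differentiable f x) /\
            (forall v, Ck_on U m ('D_v f))
  end.

Definition smooth_on (R : realType) (V W : normedModType R) (U : set V)
  (f : V -> W) : Prop := forall n, Ck_on U n f.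

Definition smooth (R : realType) (V W : normedModType R) (f : V -> W) : Prop :=
  smooth_on [set: V] f.

Section RoughPath.
Context {R : realType} {K : nat}.
Implicit Types (z Z : R -> 'rV[R]_K) (ZZ : R -> R -> 'M[R]_K).

(* Second level of the canonical lift: int_s^t (z_u - z_s) (x) dz_u. *)
Definition lift2 z (s t : R) : 'M[R]_K :=
  \matrix_(i, j) \int[lebesgue_measure]_(u in `[s, t])
     ((z u - z s) 0 i * ('D_1 z u) 0 j).

Definition rough_path (alpha t0 t1 : R) Z ZZ : Prop :=
  [/\ exists C : R, forall s t, t0 <= s -> s <= t -> t <= t1 ->
        `|Z t - Z s| <= C * (t - s) `^ alpha,
      exists C : R, forall s t, t0 <= s -> s <= t -> t <= t1 ->
        `|ZZ s t| <= C * (t - s) `^ (2 * alpha)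
    & forall s u t, t0 <= s -> s <= u -> u <= t -> t <= t1 ->
        ZZ s t = ZZ s u + ZZ u t + (Z u - Z s)^T *m (Z t - Z u)].

(* Geometric: in the closure, for the alpha-Hoelder rough path distance, of
   the canonical lifts of smooth paths. *)
Definition geometric_rough_path (alpha t0 t1 : R) Z ZZ : Prop :=
  rough_path alpha t0 t1 Z ZZ /\
  forall e : R, 0 < e -> exists2 z, smooth z &
    forall s t, t0 <= s -> s <= t -> t <= t1 ->
      `|(Z t - Z s) - (z t - z s)| <= e * (t - s) `^ alpha /\
      `|ZZ s t - lift2 z s t| <= e * (t - s) `^ (2 * alpha).

End RoughPath.

Section Gradients.
Context {R : realType} {N : nat}.

Definition inner (u v : 'rV[R]_N) : R := \sum_j u 0 j * v 0 j.

Definition grad (F : 'rV[R]_N -> R) (q : 'rV[R]_N) : 'rV[R]_N :=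
  \row_j 'D_(delta_mx 0 j) F q.

(* Points of phase space are pairs (q, p). *)
Definition grad_q (F : 'rV[R]_N * 'rV[R]_N -> R) (x : 'rV[R]_N * 'rV[R]_N) :
  'rV[R]_N := \row_j 'D_(delta_mx 0 j, 0) F x.

Definition grad_p (F : 'rV[R]_N * 'rV[R]_N -> R) (x : 'rV[R]_N * 'rV[R]_N) :
  'rV[R]_N := \row_j 'D_(0, delta_mx 0 j) F x.

End Gradients.

Section Galerkin.
Context {R : realType} {s r : nat}.

(* Control points d_0 < ... < d_s, quadrature points c_i and weights
   b_i, bbar_i; since d_0 <> d_s, such a scheme exists only for s >= 1. *)
Record galerkin_scheme := GalerkinScheme {
  node : 'I_s.+1 -> R;
  node_first : node ord0 = 0;
  node_last : node ord_max = 1;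
  node_incr : forall mu nu : 'I_s.+1, (mu < nu)%N -> node mu < node nu;
  qpoint : 'I_r -> R;
  qpoint_itv : forall i, 0 <= qpoint i <= 1;
  qpoint_mono : forall i j : 'I_r, (i <= j)%N -> qpoint i <= qpoint j;
  weight : 'I_r -> R;
  rweight : 'I_r -> R
}.

Variable G : galerkin_scheme.

Definition lagr (mu : 'I_s.+1) : {poly R} :=
  \prod_(nu < s.+1 | nu != mu)
    ((node G mu - node G nu)^-1 *: ('X - (node G nu)%:P)).

Lemma lagr_node (mu nu : 'I_s.+1) : (lagr mu).[node G nu] = (mu == nu)%:R.
Proof.
have inj a b : a != b -> node G a - node G b != 0.
  rewrite subr_eq0 -val_eqE neq_ltn => /orP[] /(node_incr G).
    by move/lt_eqF ->.
  by move/gt_eqF ->.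
rewrite horner_prod; have [<-|ne] := eqVneq mu nu.
  rewrite big1 // => k km.
  by rewrite !hornerE mulVf // inj // eq_sym.
by rewrite (bigD1 nu) 1?eq_sym //= !hornerE subrr mulr0 mul0r.
Qed.

Variables (N K : nat) (dt : R) (dZ : 'rV[R]_K).
Variables (H : 'rV[R]_N * 'rV[R]_N -> R) (Hr : 'rV[R]_N * 'rV[R]_N -> 'rV[R]_K).

(* q_d and its time derivative at time t_k + eta * dt; row mu of q is q^mu. *)
Definition qd (q : 'M[R]_(s.+1, N)) (eta : R) : 'rV[R]_N :=
  \sum_mu (lagr mu).[eta] *: row mu q.

Definition qd_dot (q : 'M[R]_(s.+1, N)) (eta : R) : 'rV[R]_N :=
  dt^-1 *: \sum_mu (deriv (lagr mu)).[eta] *: row mu q.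

(* The internal variables of a step are y = (q, P), with q^mu = row mu q and
   P_{i,k} = row i P. *)
Notation stages := ('M[R]_(s.+1, N) * 'M[R]_(r, N))%type.

Definition stageQ (y : stages) (i : 'I_r) : 'rV[R]_N := qd y.1 (qpoint G i).
Definition stageP (y : stages) (i : 'I_r) : 'rV[R]_N := row i y.2.
Definition stageQP (y : stages) (i : 'I_r) := (stageQ y i, stageP y i).

Definition Hr_coord (k : 'I_K) : 'rV[R]_N * 'rV[R]_N -> R := fun x => Hr x 0 k.

Definition stage_lhs (i : 'I_r) (y : stages) : 'rV[R]_N :=
  - ((dt * weight G i) *:
       (qd_dot y.1 (qpoint G i) - grad_p H (stageQP y i)))
  + rweight G i *: \sum_k dZ 0 k *: grad_p (Hr_coord k) (stageQP y i).

Definition momentum_lhs (mu : 'I_s.+1) (y : stages) : 'rV[R]_N :=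
  - (\sum_i weight G i *:
      ((deriv (lagr mu)).[qpoint G i] *: stageP y i
       - (dt * (lagr mu).[qpoint G i]) *: grad_q H (stageQP y i)))
  + \sum_i (rweight G i * (lagr mu).[qpoint G i]) *:
      \sum_k dZ 0 k *: grad_q (Hr_coord k) (stageQP y i).

Definition momentum_rhs (mu : 'I_s.+1) (p p' : 'rV[R]_N) : 'rV[R]_N :=
  if mu == ord0 then p else if mu == ord_max then - p' else 0.

Definition galerkin_step (qk pk1 : 'rV[R]_N) (y : stages)
    (pk qk1 : 'rV[R]_N) : Prop :=
  [/\ row ord0 y.1 = qk,
      forall i, stage_lhs i y = 0,
      forall mu, momentum_lhs mu y = momentum_rhs mu pk pk1
    & qk1 = row ord_max y.1].

(* The equations of galerkin_step differentiated along a curve through y with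
   velocity dy; the right-hand sides momentum_rhs are linear in the momenta.
   Lemma linearised_stepE below gives the form with second derivatives of the
   Hamiltonians. *)
Definition linearised_step (y : stages) (dqk dpk1 : 'rV[R]_N) (dy : stages)
    (dpk dqk1 : 'rV[R]_N) : Prop :=
  [/\ row ord0 dy.1 = dqk,
      forall i, 'D_dy (stage_lhs i) y = 0,
      forall mu, 'D_dy (momentum_lhs mu) y = momentum_rhs mu dpk dpk1
    & dqk1 = row ord_max dy.1].

End Galerkin.

Arguments galerkin_scheme : clear implicits.

Section Variations.
Context {R : realType} {N : nat}.
Implicit Types (F : 'rV[R]_N * 'rV[R]_N -> R) (x dx : 'rV[R]_N * 'rV[R]_N).

(* Row l, column j: the j-th component of the gradient (second letter)
   differentiated in the l-th variable (first letter). *)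
Definition hess_pp F x : 'M[R]_N :=
  \matrix_(l, j) 'D_(0, delta_mx 0 l) ('D_(0, delta_mx 0 j) F) x.
Definition hess_qp F x : 'M[R]_N :=
  \matrix_(l, j) 'D_(delta_mx 0 l, 0) ('D_(0, delta_mx 0 j) F) x.
Definition hess_pq F x : 'M[R]_N :=
  \matrix_(l, j) 'D_(0, delta_mx 0 l) ('D_(delta_mx 0 j, 0) F) x.
Definition hess_qq F x : 'M[R]_N :=
  \matrix_(l, j) 'D_(delta_mx 0 l, 0) ('D_(delta_mx 0 j, 0) F) x.

(* delta F^p and delta F^q at x for the variation dx = (dQ, dP). *)
Definition var_p F x dx := dx.2 *m hess_pp F x + dx.1 *m hess_qp F x.
Definition var_q F x dx := dx.1 *m hess_qq F x + dx.2 *m hess_pq F x.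

Lemma smooth_diffD F v x : smooth F -> differentiable ('D_v F) x.
Proof. by move=> /(_ 2%N)[_ /(_ v)[+ _]]; apply. Qed.

Lemma is_derive_row_mx (g : 'I_N -> 'rV[R]_N * 'rV[R]_N -> R) x dx :
  (forall j, differentiable (g j) x) ->
  is_derive x dx (fun y => \row_j g j y)
    (dx.1 *m (\matrix_(l, j) 'D_(delta_mx 0 l, 0) (g j) x)
     + dx.2 *m (\matrix_(l, j) 'D_(0, delta_mx 0 l) (g j) x)).
Proof.
move=> dg.
have dvg j : derivable (g j) x dx by exact: diff_derivable.
have dM : derivable (fun y => \row_j g j y) x dx.
  apply/derivable_mxP => i j.
  by rewrite (_ : (fun _ => _) = g j)//; apply/funext => y; rewrite mxE.
apply: DeriveDef => //; rewrite derive_mx//.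
apply/rowP => j; rewrite !mxE.
rewrite (_ : (fun _ => _) = g j); last by apply/funext => y; rewrite mxE.
rewrite deriveE//.
have E1 (u : 'rV[R]_N) : (u, 0 : 'rV[R]_N) = \sum_l u 0 l *: (delta_mx 0 l, 0).
  rewrite [in LHS](row_sum_delta u).
  rewrite (big_morph (fun w => (w, 0 : 'rV[R]_N)) (id1 := 0) (op1 := +%R)) //.
    by apply: eq_bigr => l _; congr pair; rewrite /= scaler0.
  by move=> v w; congr pair; rewrite /= addr0.
have E2 (u : 'rV[R]_N) : (0 : 'rV[R]_N, u) = \sum_l u 0 l *: (0, delta_mx 0 l).
  rewrite [in LHS](row_sum_delta u).
  rewrite (big_morph (fun w => (0 : 'rV[R]_N, w)) (id1 := 0) (op1 := +%R)) //.
    by apply: eq_bigr => l _; congr pair; rewrite /= scaler0.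
  by move=> v w; congr pair; rewrite /= addr0.
have -> : dx = (dx.1, 0) + (0, dx.2).
  by rewrite [LHS]surjective_pairing; congr pair; rewrite /= ?addr0 ?add0r.
rewrite /= addr0 add0r [in LHS]E1 [in LHS]E2.
rewrite linearD !linear_sum /=; congr (_ + _); apply: eq_bigr => l _;
  by rewrite linearZ mxE deriveE//= /fst_ /snd_; congr (_ *: _).
Qed.
End Variations.

Section Explicit.
Context {R : realType} {s r N K : nat}.
Variables (G : galerkin_scheme R s r) (dt : R) (dZ : 'rV[R]_K).
Variables (H : 'rV[R]_N * 'rV[R]_N -> R) (Hr : 'rV[R]_N * 'rV[R]_N -> 'rV[R]_K).
Notation stages := ('M[R]_(s.+1, N) * 'M[R]_(r, N))%type.

Lemma is_derive_lin (V W : normedModType R) (A : V -> W) y v :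
  linear A -> is_derive y v A (A v).
Proof.
move=> linA.
have E (h : R) : h != 0 -> h^-1 *: ((A \o shift y) (h *: v) - A y) = A v.
  by move=> h0; rewrite /= linA addrK scalerA mulVf// scale1r.
have C : h^-1 *: ((A \o shift y) (h *: v) - A y) @[h --> 0^'] --> A v.
  apply: cvg_near_cst; near=> h; apply: E.
  by near: h; exact: nbhs_dnbhs_neq.
by apply: DeriveDef; [apply/cvg_ex; exists (A v)|exact: cvg_lim].
Unshelve. all: by end_near. Qed.

Lemma is_derive_comp_lin (V V' W : normedModType R) (A : V -> V') (g : V' -> W)
    y v w : linear A -> is_derive (A y) (A v) g w ->
  is_derive y v (fun y => g (A y)) w.
Proof.
move=> linA [dg <-].
have E : (fun h : R => h^-1 *: (((fun y => g (A y)) \o shift y) (h *: v) - g (A y)))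
  = (fun h => h^-1 *: ((g \o shift (A y)) (h *: A v) - g (A y))).
  by apply/funext => h /=; rewrite linA.
by apply: DeriveDef; rewrite /derivable /derive E.
Qed.

Lemma stageQP_linear i : linear (fun y : stages => stageQP G y i).
Proof.
move=> a u v; congr pair; rewrite /= /stageQ /stageP /qd /=; last first.
  by rewrite linearP.
rewrite scaler_sumr -big_split /=; apply: eq_bigr => mu _.
by rewrite linearP scalerDr !scalerA mulrC.
Qed.

Lemma qd_dot_linear eta : linear (fun y : stages => qd_dot G dt y.1 eta).
Proof.
move=> a u v; rewrite /qd_dot /= scalerA mulrC -scalerA -scalerDr; congr (_ *: _).
rewrite scaler_sumr -big_split /=; apply: eq_bigr => mu _.
by rewrite linearP scalerDr !scalerA mulrC.
Qed.

Definition stage_var i (y dy : stages) :=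
  - ((dt * weight G i) *:
      (qd_dot G dt dy.1 (qpoint G i) - var_p H (stageQP G y i) (stageQP G dy i)))
  + rweight G i *:
     \sum_k dZ 0 k *: var_p (Hr_coord Hr k) (stageQP G y i) (stageQP G dy i).

Definition momentum_var mu (y dy : stages) :=
  - (\sum_i weight G i *:
      ((deriv (lagr G mu)).[qpoint G i] *: stageP dy i
       - (dt * (lagr G mu).[qpoint G i]) *:
           var_q H (stageQP G y i) (stageQP G dy i)))
  + \sum_i (rweight G i * (lagr G mu).[qpoint G i]) *:
      \sum_k dZ 0 k *: var_q (Hr_coord Hr k) (stageQP G y i) (stageQP G dy i).

Hypothesis sH : smooth H.
Hypothesis sHr : forall k, smooth (Hr_coord Hr k).

Lemma is_derive_grad_p (F : 'rV[R]_N * 'rV[R]_N -> R) i y dy : smooth F ->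
  is_derive y dy (fun y => grad_p F (stageQP G y i))
    (var_p F (stageQP G y i) (stageQP G dy i)).
Proof.
move=> sF; apply: (is_derive_comp_lin (@stageQP_linear i)).
rewrite /var_p addrC; apply: is_derive_row_mx => j; exact: smooth_diffD.
Qed.

Lemma is_derive_grad_q (F : 'rV[R]_N * 'rV[R]_N -> R) i y dy : smooth F ->
  is_derive y dy (fun y => grad_q F (stageQP G y i))
    (var_q F (stageQP G y i) (stageQP G dy i)).
Proof.
move=> sF; apply: (is_derive_comp_lin (@stageQP_linear i)).
apply: is_derive_row_mx => j; exact: smooth_diffD.
Qed.

Lemma is_derive_sumf (V W : normedModType R) n (h : 'I_n -> V -> W) x v dh :
  (forall i, is_derive x v (h i) (dh i)) ->
  is_derive x v (fun y => \sum_i h i y) (\sum_i dh i).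
Proof.
move=> D; rewrite (_ : (fun y => _) = \sum_i h i); last first.
  by apply/funext => y; rewrite fct_sumE.
exact: is_derive_sum.
Qed.

Lemma is_derive_stage i y dy :
  is_derive y dy (stage_lhs G dt dZ H Hr i) (stage_var i y dy).
Proof.
apply: is_deriveD.
  apply: is_deriveN; apply: is_deriveZ; apply: is_deriveB.
    exact/is_derive_lin/qd_dot_linear.
  exact: is_derive_grad_p.
apply: is_deriveZ; apply: is_derive_sumf => k; apply: is_deriveZ.
exact: is_derive_grad_p.
Qed.

Lemma is_derive_momentum mu y dy :
  is_derive y dy (momentum_lhs G dt dZ H Hr mu) (momentum_var mu y dy).
Proof.
apply: is_deriveD.
  apply: is_deriveN; apply: is_derive_sumf => i; apply: is_deriveZ.
  apply: is_deriveB; apply: is_deriveZ.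
    by apply/is_derive_lin => a u v; rewrite /stageP linearP.
  exact: is_derive_grad_q.
apply: is_derive_sumf => i; apply: is_deriveZ; apply: is_derive_sumf => k.
apply: is_deriveZ; exact: is_derive_grad_q.
Qed.

Lemma linearised_stepE y dqk dpk1 dy dpk dqk1 :
  linearised_step G dt dZ H Hr y dqk dpk1 dy dpk dqk1 <->
  [/\ row ord0 dy.1 = dqk,
      forall i, stage_var i y dy = 0,
      forall mu, momentum_var mu y dy = momentum_rhs mu dpk dpk1
    & dqk1 = row ord_max dy.1].
Proof.
by split=> -[? E1 E2 ?]; split => // a; move: (E1, E2) => [] D1 D2;
  [rewrite -(D1 a)|rewrite -(D2 a)|rewrite -(D1 a)|rewrite -(D2 a)];
  rewrite (@derive_val _ _ _ _ _ _ _ (is_derive_stage _ _ _)) ||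
  rewrite (@derive_val _ _ _ _ _ _ _ (is_derive_momentum _ _ _)).
Qed.
End Explicit.

(* Main.v *)
Require Import Defs.
From HB Require Import structures.
From mathcomp Require Import all_boot all_order all_algebra.
From mathcomp Require Import all_classical all_reals all_analysis.
From mathcomp Require Import ring.
Set Implicit Arguments.
Unset Strict Implicit.
Unset Printing Implicit Defensive.
Import Order.TTheory GRing.Theory Num.Theory.
Import numFieldNormedType.Exports.
Local Open Scope classical_set_scope.
Local Open Scope ring_scope.

(** In continuous time the law is a cancellation.  With H = <p, f(q)> + L(q) the
    equations are q' = f(q), p' = - Df(q)^T p - grad L(q), and the first one
    linearises to (dq)' = Df(q) dq, whence <p, dq>' = - <grad L(q), dq>: only the
    variation of the p-free part L survives, and the term driven by the rough
    path behaves in the same way.  The discrete proof reproduces this.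

    Pair the momentum equation of index mu with dq^mu and sum over mu.  The
    right-hand sides give <p_k, dq_k> - <p_{k+1}, dq_{k+1}>
    ([sum_momentum_rhs]; the two ends are distinct since d_0 = 0 and d_s = 1).
    On the left, summing the Lagrange polynomials against the dq^mu rebuilds
    dQ_i and the discrete velocity of dq_d at c_i ([sum_momentum_lhs]), so the
    sum becomes one over the stages i, of
      - dt b_i (<P_i, velocity of dq_d at c_i> - <dH/dq, dQ_i>)
      + bbar_i <dHr/dq, dQ_i> . Z.
    When F(q, p) = <p, g(q)> + E(q), one has dF/dp = g(q) and
    <dF/dq, v> = <p, Dg(q) v> + <grad E(q), v> ([grad_p_affine],
    [inner_grad_q_affine]).  Hence the linearised stage equation involves no
    variation of P_i ([derive_stage_affine]), and its pairing with P_i is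
    precisely the part of the above sum made of the velocity and the
    <P_i, Dg(Q_i) dQ_i>; this part vanishes, and what remains is the variation of
    L and frakL ([galerkin_quasi_conservation], for one step of arbitrary nonzero
    size and arbitrary driving increment). *)

(** * The inner product as a linear form *)

Section InnerProduct.
Context {R : realType} {N : nat}.
Implicit Types u v w : 'rV[R]_N.

Lemma innerC u v : inner u v = inner v u.
Proof. by apply: eq_bigr => j _; rewrite mulrC. Qed.

Lemma inner_linear u : linear_for *%R (inner u).
Proof.
move=> a v w; rewrite /inner mulr_sumr -big_split /=.
by apply: eq_bigr => j _; rewrite !mxE mulrDr mulrCA.
Qed.

HB.instance Definition _ u := GRing.isLinear.Build R _ _ _ _ (inner_linear u).

Lemma inner0r u : inner u 0 = 0. Proof. exact: linear0. Qed.
Lemma innerNr u v : inner u (- v) = - inner u v. Proof. exact: linearN. Qed.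
Lemma innerDr u v w : inner u (v + w) = inner u v + inner u w.
Proof. exact: linearD. Qed.
Lemma innerZr u a v : inner u (a *: v) = a * inner u v.
Proof. exact: linearZ. Qed.
Lemma inner_sumr I (e : seq I) (P : pred I) u (h : I -> 'rV[R]_N) :
  inner u (\sum_(i <- e | P i) h i) = \sum_(i <- e | P i) inner u (h i).
Proof. exact: linear_sum. Qed.

End InnerProduct.

(** * Differentiating inner products *)

Section Differentiability.
Context {R : realType} {V : normedModType R}.

Lemma differentiable_mxE m n (A : V -> 'M[R]_(m, n)) i j x :
  differentiable A x -> differentiable (fun y => A y i j) x.
Proof.
move=> dA; apply: (@differentiable_comp _ _ _ _ A (fun M : 'M[R]_(m, n) => M i j)) => //.
exact: differentiable_coord.
Qed.

(** Differentiability of [g] is asked coordinate by coordinate because that is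
    what a column of a smooth matrix-valued map directly provides. *)
Lemma differentiable_inner n p (g : V -> 'rV[R]_n) x :
  (forall j, differentiable (fun y => g y 0 j) x) ->
  differentiable (fun y => inner p (g y)) x.
Proof.
move=> dg; rewrite (_ : (fun y => _) = \sum_j (fun y => p 0 j *: g y 0 j)).
  by apply: differentiable_sum => j; exact: differentiableZ.
by apply/funext => y; rewrite fct_sumE.
Qed.

Lemma derivable_rowP n (g : V -> 'rV[R]_n) x v :
  (forall j, differentiable (fun y => g y 0 j) x) -> derivable g x v.
Proof.
move=> dg; apply/derivable_mxP => i j; rewrite (ord1 i).
exact: diff_derivable.
Qed.

Lemma derive_inner n p (g : V -> 'rV[R]_n) x v :
  (forall j, differentiable (fun y => g y 0 j) x) ->
  'D_v (fun y => inner p (g y)) x = inner p ('D_v g x).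
Proof.
move=> dg; rewrite (_ : (fun y => _) = \sum_j (fun y => p 0 j *: g y 0 j)).
  have dgv j : derivable (fun y => g y 0 j) x v by exact: diff_derivable.
  rewrite derive_sum; last by move=> j; exact: derivableZ.
  apply: eq_bigr => j _; rewrite deriveZ// derive_mx; last exact: derivable_rowP.
  by rewrite mxE.
by apply/funext => y; rewrite fct_sumE.
Qed.

End Differentiability.

(** * Hamiltonians affine in the momentum *)

Section AffineHamiltonian.
Context {R : realType} {N : nat}.
Implicit Types (q p v : 'rV[R]_N) (F : 'rV[R]_N * 'rV[R]_N -> R).

Lemma inner_grad (E : 'rV[R]_N -> R) q v :
  differentiable E q -> inner (grad E q) v = 'D_v E q.
Proof.
move=> dE; rewrite [in RHS](row_sum_delta v) deriveE// linear_sum.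
by apply: eq_bigr => j _; rewrite linearZ mxE deriveE// mulrC.
Qed.

Lemma grad_cst0 (E : 'rV[R]_N -> R) q : (forall q', E q' = 0) -> grad E q = 0.
Proof.
move=> E0; rewrite (_ : E = cst 0); last exact/funext.
by apply/rowP => j; rewrite !mxE derive_cst.
Qed.

(** The difference quotients coincide, so derivatives in phase space reduce to
    derivatives in one variable, where the affine form of [F] can be used. *)
Lemma grad_qE F q p : grad_q F (q, p) = grad (fun q' => F (q', p)) q.
Proof.
apply/rowP => j; rewrite !mxE /derive; congr (lim (_ @ 0^')).
apply/funext => h /=; congr (_ *: (F _ - _)).
by congr pair; rewrite /= scaler0 add0r.
Qed.

Lemma grad_pE F q p : grad_p F (q, p) = grad (fun p' => F (q, p')) p.
Proof.
apply/rowP => j; rewrite !mxE /derive; congr (lim (_ @ 0^')).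
apply/funext => h /=; congr (_ *: (F _ - _)).
by congr pair; rewrite /= scaler0 add0r.
Qed.

Definition affine_in_p F (g : 'rV[R]_N -> 'rV[R]_N) (E : 'rV[R]_N -> R) :=
  forall q p, F (q, p) = inner p (g q) + E q.

Variables (F : 'rV[R]_N * 'rV[R]_N -> R) (g : 'rV[R]_N -> 'rV[R]_N).
Variable E : 'rV[R]_N -> R.
Hypothesis affF : affine_in_p F g E.

Lemma grad_p_affine q p : grad_p F (q, p) = g q.
Proof.
rewrite grad_pE; apply/rowP => j; rewrite mxE.
rewrite (_ : (fun p' => _) = (fun p' => inner (g q) p' + E q)); last first.
  by apply/funext => p'; rewrite affF innerC.
have D : is_derive p (delta_mx 0 j) (inner (g q)) (inner (g q) (delta_mx 0 j)).
  exact/is_derive_lin/inner_linear.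
rewrite deriveD// derive_cst addr0 derive_val /inner (bigD1 j)//= big1.
  by rewrite mxE !eqxx mulr1 addr0.
by move=> i /negPf ij; rewrite mxE ij andbF mulr0.
Qed.

Hypothesis dg : forall q j, differentiable (fun q' => g q' 0 j) q.
Hypothesis dE : forall q, differentiable E q.

(** This links the two equations of a stage: the term <p, Dg(q) v> is the one
    that the linearised stage equation produces from the p-gradient [g]. *)
Lemma inner_grad_q_affine q p v :
  inner (grad_q F (q, p)) v = inner p ('D_v g q) + inner (grad E q) v.
Proof.
rewrite grad_qE (_ : (fun q' => _) = (fun q' => inner p (g q')) + E).
  have dpg := differentiable_inner p (dg q).
  rewrite !inner_grad//; last exact: differentiableD.
  by rewrite deriveD ?derive_inner//; exact: diff_derivable.
by apply/funext => q'; rewrite affF.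
Qed.

End AffineHamiltonian.

(** * One step of the integrator *)

Section OneStep.
Context {R : realType} {s r N K : nat}.
Variables (G : galerkin_scheme R s r) (dt : R) (dZ : 'rV[R]_K).
Variables (H : 'rV[R]_N * 'rV[R]_N -> R) (Hr : 'rV[R]_N * 'rV[R]_N -> 'rV[R]_K).
Notation stages := ('M[R]_(s.+1, N) * 'M[R]_(r, N))%type.
Implicit Types (y dy : stages).

Lemma first_last_neq : (ord0 : 'I_s.+1) != ord_max.
Proof.
apply/eqP => e; have := node_last G; rewrite -e node_first => /eqP.
by rewrite eq_sym oner_eq0.
Qed.

Lemma sum_momentum_rhs (p p' : 'rV[R]_N) (q : 'M[R]_(s.+1, N)) :
  \sum_mu inner (momentum_rhs mu p p') (row mu q) =
  inner p (row ord0 q) - inner p' (row ord_max q).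
Proof.
rewrite (bigD1 ord0)//= (bigD1 ord_max) 1?eq_sym ?first_last_neq//= big1 => [|mu].
  rewrite /momentum_rhs !eqxx eq_sym (negPf first_last_neq) addr0.
  by congr (_ + _); rewrite innerC innerNr innerC.
by move=> /andP[/negPf m0 /negPf m1]; rewrite /momentum_rhs m0 m1 innerC inner0r.
Qed.

(** The interpolation is linear in the control points, so testing the momentum
    equations against the variations dq^mu amounts to testing at the quadrature
    points against dQ_i and the velocity of dq_d. *)
Lemma sum_momentum_lhs y dy : dt != 0 ->
  \sum_mu inner (momentum_lhs G dt dZ H Hr mu y) (row mu dy.1) =
  \sum_i (- (dt * weight G i * (inner (stageP y i) (qd_dot G dt dy.1 (qpoint G i))
              - inner (grad_q H (stageQP G y i)) (stageQ G dy i)))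
          + rweight G i * \sum_k dZ 0 k *
              inner (grad_q (Hr_coord Hr k) (stageQP G y i)) (stageQ G dy i)).
Proof.
move=> dt0.
under eq_bigr => mu _.
  rewrite innerC /momentum_lhs -sumrN -big_split inner_sumr /=.
  under eq_bigr => i _.
    rewrite innerDr innerNr !innerZr innerDr innerNr !innerZr inner_sumr.
    under eq_bigr => k _ do rewrite innerZr innerC.
    rewrite ![inner (row mu dy.1) _]innerC.
  over.
over.
rewrite exchange_big; apply: eq_bigr => i _ /=.
rewrite big_split sumrN /=; congr (- _ + _).
  rewrite -mulr_sumr sumrB [dt * _]mulrC -mulrA; congr (_ * _).
  rewrite mulrBr /qd_dot /stageQ /qd innerZr mulrA mulfV// mul1r.
  rewrite !inner_sumr mulr_sumr; congr (_ - _); apply: eq_bigr => mu _.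
    by rewrite innerZr.
  by rewrite innerZr mulrA.
under eq_bigr => mu _ do rewrite -mulrA mulr_sumr.
rewrite -mulr_sumr exchange_big /=; congr (_ * _); apply: eq_bigr => k _.
rewrite /stageQ /qd inner_sumr mulr_sumr; apply: eq_bigr => mu _.
by rewrite innerZr mulrCA.
Qed.

Variables (f : 'rV[R]_N -> 'rV[R]_N) (g : 'I_K -> 'rV[R]_N -> 'rV[R]_N).
Variables (L : 'rV[R]_N -> R) (Lr : 'I_K -> 'rV[R]_N -> R).
Hypothesis affH : affine_in_p H f L.
Hypothesis affHr : forall k, affine_in_p (Hr_coord Hr k) (g k) (Lr k).
Hypothesis df : forall q j, differentiable (fun q' => f q' 0 j) q.
Hypothesis dg : forall k q j, differentiable (fun q' => g k q' 0 j) q.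
Hypothesis dL : forall q, differentiable L q.
Hypothesis dLr : forall k q, differentiable (Lr k) q.

(** The p-gradients of the affine Hamiltonians are [f] and [g k], functions of q
    alone, so the variations of the stage momenta drop out. *)
Lemma derive_stage_affine i y dy :
  'D_dy (stage_lhs G dt dZ H Hr i) y =
  - ((dt * weight G i) *: (qd_dot G dt dy.1 (qpoint G i)
                          - 'D_(stageQ G dy i) f (stageQ G y i)))
  + rweight G i *: \sum_k dZ 0 k *: 'D_(stageQ G dy i) (g k) (stageQ G y i).
Proof.
have stageQ_linear : linear (fun y : stages => stageQ G y i).
  by move=> a u v; have [] := stageQP_linear G i a u v.
have D (h : 'rV[R]_N -> 'rV[R]_N) :
    (forall q j, differentiable (fun q' => h q' 0 j) q) ->
    is_derive y dy (fun y => h (stageQ G y i))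
      ('D_(stageQ G dy i) h (stageQ G y i)).
  move=> dh; apply: (is_derive_comp_lin stageQ_linear).
  exact/derivableP/derivable_rowP.
apply: derive_val; rewrite (_ : stage_lhs _ _ _ _ _ i = fun y =>
  - ((dt * weight G i) *: (qd_dot G dt y.1 (qpoint G i) - f (stageQ G y i)))
  + rweight G i *: \sum_k dZ 0 k *: g k (stageQ G y i)); last first.
  apply/funext => z; rewrite /stage_lhs (grad_p_affine affH); congr (_ + _ *: _).
  by apply: eq_bigr => k _; rewrite (grad_p_affine (affHr k)).
apply: is_deriveD.
  apply: is_deriveN; apply: is_deriveZ; apply: is_deriveB; last exact: D.
  exact/is_derive_lin/qd_dot_linear.
apply: is_deriveZ; apply: is_derive_sumf => k; apply: is_deriveZ.
exact: D.
Qed.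

(** The sum of the momentum equations tested against dq^mu is the sum of
    the linearised stage equations tested against P_i, up to the variation of
    [L] and [Lr]. *)
Lemma galerkin_quasi_conservation qk pk1 y pk qk1 dqk dpk1 dy dpk dqk1 :
  dt != 0 -> galerkin_step G dt dZ H Hr qk pk1 y pk qk1 ->
  linearised_step G dt dZ H Hr y dqk dpk1 dy dpk dqk1 ->
  inner pk dqk = inner pk1 dqk1
    + dt * (\sum_i weight G i * inner (grad L (stageQ G y i)) (stageQ G dy i))
    + \sum_i rweight G i *
        \sum_k inner (grad (Lr k) (stageQ G y i)) (stageQ G dy i) * dZ 0 k.
Proof.
move=> dt0 [_ _ momentum _] [<- dstage _ ->].
rewrite -addrA; apply/eqP; rewrite addrC -subr_eq -sum_momentum_rhs; apply/eqP.
under eq_bigr => mu _ do rewrite -momentum.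
rewrite sum_momentum_lhs// mulr_sumr -big_split; apply: eq_bigr => i _ /=.
have stage_eq := congr1 (inner (stageP y i)) (dstage i).
rewrite derive_stage_affine inner0r innerDr innerNr in stage_eq.
rewrite !innerZr innerDr innerNr inner_sumr in stage_eq.
rewrite (eq_bigr _ (fun k _ => innerZr _ (dZ 0 k) _)) in stage_eq.
rewrite (inner_grad_q_affine affH df dL).
under eq_bigr => k _.
  rewrite (inner_grad_q_affine (affHr k) (dg k) (dLr k)) mulrDr.
  rewrite [dZ 0 k * inner (grad _ _) _]mulrC.
over.
(* The left-hand side of stage_eq is what must vanish in the goal: it stands in
   for the 0 added on the right. *)
by rewrite big_split /= -[RHS]add0r -[X in _ = X + _]stage_eq; ring.
Qed.

End OneStep.

(** * The conservation law along the integrator *)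

Theorem proposition3p4 (R : realType) (N K s r : nat)
    (G : galerkin_scheme R s r)
    (* the driving geometric rough path and the time step *)
    (alpha t0 t1 : R) (halpha : 3^-1 < alpha <= 2^-1)
    (Z : R -> 'rV[R]_K) (ZZ : R -> R -> 'M[R]_K)
    (hZ : geometric_rough_path alpha t0 t1 Z ZZ)
    (tk tk1 : R) (htk : t0 <= tk) (hstep : tk < tk1) (htk1 : tk1 <= t1)
    (* the Hamiltonians, affine in p *)
    (f : 'rV[R]_N -> 'rV[R]_N) (sigma : 'rV[R]_N -> 'M[R]_(N, K))
    (L : 'rV[R]_N -> R) (Lr : 'rV[R]_N -> 'rV[R]_K)
    (hf : smooth f) (hsigma : smooth sigma) (hL : smooth L) (hLr : smooth Lr)
    (H : 'rV[R]_N * 'rV[R]_N -> R) (Hr : 'rV[R]_N * 'rV[R]_N -> 'rV[R]_K)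
    (hH : forall q p, H (q, p) = inner p (f q) + L q)
    (hHr : forall q p, Hr (q, p) = p *m sigma q + Lr q)
    (* the integrator, solvable with stages Y smooth in (q_k, p_{k+1}) in U,
       and the resulting p_k and q_{k+1} *)
    (U : set ('rV[R]_N * 'rV[R]_N)) (hU : open U)
    (Y : 'rV[R]_N * 'rV[R]_N -> 'M[R]_(s.+1, N) * 'M[R]_(r, N))
    (pS qS : 'rV[R]_N * 'rV[R]_N -> 'rV[R]_N)
    (hY : smooth_on U Y)
    (hsol : forall qk pk1, U (qk, pk1) ->
       galerkin_step G (tk1 - tk) (Z tk1 - Z tk) H Hr
         qk pk1 (Y (qk, pk1)) (pS (qk, pk1)) (qS (qk, pk1)))
    (* a solution of the integrator and of the linearised integrator *)
    (qk pk1 : 'rV[R]_N) (hqp : U (qk, pk1))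
    (dqk dpk1 : 'rV[R]_N) (dy : 'M[R]_(s.+1, N) * 'M[R]_(r, N))
    (dpk dqk1 : 'rV[R]_N)
    (hlin : linearised_step G (tk1 - tk) (Z tk1 - Z tk) H Hr
       (Y (qk, pk1)) dqk dpk1 dy dpk dqk1) :
  inner (pS (qk, pk1)) dqk =
    inner pk1 dqk1
    + (tk1 - tk) * (\sum_(i < r) weight G i *
        inner (grad L (stageQ G (Y (qk, pk1)) i)) (stageQ G dy i))
    + \sum_(i < r) rweight G i *
        (\sum_(k < K)
           inner (grad (fun q => Lr q 0 k) (stageQ G (Y (qk, pk1)) i))
             (stageQ G dy i) * (Z tk1 - Z tk) 0 k)
  /\ ((forall q, L q = 0) -> (forall q, Lr q = 0) ->
      inner pk1 dqk1 = inner (pS (qk, pk1)) dqk).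
Proof.
have df_coord q j : differentiable (fun q' => f q' 0 j) q.
  by apply: differentiable_mxE; have [+ _] := hf 1%N; apply.
have dsigma_coord k q j : differentiable (fun q' => (col k (sigma q'))^T 0 j) q.
  rewrite (_ : (fun _ => _) = fun q' => sigma q' j k).
    by apply: differentiable_mxE; have [+ _] := hsigma 1%N; apply.
  by apply/funext => q'; rewrite !mxE.
have dL q : differentiable L q by have [+ _] := hL 1%N; apply.
have dLr k q : differentiable (fun q' => Lr q' 0 k) q.
  by apply: differentiable_mxE; have [+ _] := hLr 1%N; apply.
have affHr k : affine_in_p (Hr_coord Hr k) (fun q => (col k (sigma q))^T)
    (fun q => Lr q 0 k).
  move=> q p; rewrite /Hr_coord hHr !mxE; congr (_ + _).
  by apply: eq_bigr => j _; rewrite !mxE.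
have dt0 : tk1 - tk != 0 by rewrite subr_eq0 gt_eqF.
have quasi := galerkin_quasi_conservation hH affHr df_coord dsigma_coord dL dLr dt0
  (hsol _ _ hqp) hlin.
split=> // L0 Lr0; rewrite quasi.
rewrite [X in _ * X]big1 => [|i _]; last first.
  by rewrite grad_cst0// innerC inner0r mulr0.
rewrite big1 => [|i _]; first by rewrite mulr0 !addr0.
rewrite big1 ?mulr0// => k _.
by rewrite grad_cst0 => [|q]; rewrite ?Lr0 ?mxE// innerC inner0r mul0r.
Qed.
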